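(* There is an absolute constant $C$ such that the following holds. Let $d_1,d_2\ge2$, let $T$ be large enough that $\delta:=T^{-1/6}<\min\{\frac1{d_1},\frac1{d_2}\}$, and let $\eta=T^{1/6}$. Let $\{A_t\}_{t=1}^T$ be any sequence of payoff matrices in $[-1,1]^{d_1\times d_2}$ chosen by an adaptive adversary, and let $\{(e_{x,t},e_{y,t})\}_{t=1}^T$ be the actions generated by the algorithm Bandit-OMG-RFTL with parameters $\eta,\delta$. Then $$\Bigl|\mathbb{E}\Bigl[\sum_{t=1}^Te_{x,t}^\top A_te_{y,t}-\min_{x\in\Delta_X}\max_{y\in\Delta_Y}\sum_{t=1}^Tx^\top A_ty\Bigr]\Bigr|\le C\,(d_1+d_2)\ln(T)\,T^{5/6},$$ where the expectation is with respect to all the randomization used in the algorithm.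
   Context: $\Delta_X=\{x\in\mathbb{R}^{d_1}:x\ge0,\|x\|_1=1\}$, $\Delta_Y=\{y\in\mathbb{R}^{d_2}:y\ge0,\|y\|_1=1\}$; $\Delta_{X,\delta}=\{x\in\Delta_X:x_i\ge\delta\ \forall i\}$, $\Delta_{Y,\delta}=\{y\in\Delta_Y:y_j\ge\delta\ \forall j\}$. Adaptive adversary: $A_t$ may depend on the players' actions up to time $t-1$, but the adversary does not observe the actions $e_{x,t},e_{y,t}$ sampled in round $t$ when choosing $A_t$. Bandit-OMG-RFTL with parameters $\eta>0$, $0<\delta<\min\{1/d_1,1/d_2\}$: let $R_X(x)=\sum_{i=1}^{d_1}x_i\ln x_i+\ln d_1$, $R_Y(y)=\sum_{j=1}^{d_2}y_j\ln y_j+\ln d_2$. Start with $x_1\in\Delta_{X,\delta}$, $y_1\in\Delta_{Y,\delta}$. In round $t$: sample independently (given the past) a standard unit vector $e_{x,t}\in\mathbb{R}^{d_1}$ equal to $e_i$ with probability $(x_t)_i$ and $e_{y,t}\in\mathbb{R}^{d_2}$ equal to $e_j$ with probability $(y_t)_j$; observe only the number $e_{x,t}^\top A_te_{y,t}$; if $e_{x,t}=e_{i'}$ and $e_{y,t}=e_{j'}$, let $\hat A_t$ be the $d_1\times d_2$ matrix whose only possibly nonzero entry is $(\hat A_t)_{i',j'}=\frac{(A_t)_{i',j'}}{(x_t)_{i'}(y_t)_{j'}}$; put $\mathcal{L}_t(x,y)=x^\top\hat A_ty+\frac1\eta R_X(x)-\frac1\eta R_Y(y)$; set $x_{t+1}=\arg\min_{x\in\Delta_{X,\delta}}\max_{y\in\Delta_{Y,\delta}}\sum_{\tau=1}^t\mathcal{L}_\tau(x,y)$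 and $y_{t+1}=\arg\max_{y\in\Delta_{Y,\delta}}\min_{x\in\Delta_{X,\delta}}\sum_{\tau=1}^t\mathcal{L}_\tau(x,y)$. *)

(* Defs.v *)
From mathcomp Require Import all_boot all_order all_algebra.
From mathcomp Require Import all_classical all_reals all_analysis.

Set Implicit Arguments.
Unset Strict Implicit.
Unset Printing Implicit Defensive.

Import Order.TTheory GRing.Theory Num.Theory.

Local Open Scope classical_set_scope.
Local Open Scope ring_scope.

Definition simplex (R : realType) (d : nat) : set 'cV[R]_d :=
  [set x | (forall i, 0 <= x i 0) /\ \sum_i `|x i 0| = 1].

Definition tsimplex (R : realType) (d : nat) (delta : R) : set 'cV[R]_d :=
  [set x | simplex x /\ forall i, delta <= x i 0].

Definition bilin (R : realType) (d1 d2 : nat)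
    (x : 'cV[R]_d1) (A : 'M[R]_(d1, d2)) (y : 'cV[R]_d2) : R :=
  (x^T *m A *m y) 0 0.

Definition unit_vec (R : realType) (d : nat) (i : 'I_d) : 'cV[R]_d :=
  delta_mx i 0.

(* Here [ln 0 = 0], so the convention 0 ln 0 = 0 is respected. *)
Definition neg_entropy (R : realType) (d : nat) (x : 'cV[R]_d) : R :=
  \sum_i x i 0 * ln (x i 0) + ln d%:R.

(* [sup] and [inf] are real-valued, with junk value 0 for unbounded or empty
   sets.  They are only used below for continuous functions on nonempty compact
   sets, where they are the maximum and the minimum. *)
Definition max_over (R : realType) (V : Type) (Y : set V) (g : V -> R) : R :=
  sup [set g y | y in Y].

Definition min_over (R : realType) (U : Type) (X : set U) (g : U -> R) : R :=
  inf [set g x | x in X].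

Definition is_argmin (R : realType) (U : Type) (X : set U) (g : U -> R)
    (x : U) : Prop :=
  X x /\ forall x', X x' -> g x <= g x'.

Definition is_argmax (R : realType) (V : Type) (Y : set V) (g : V -> R)
    (y : V) : Prop :=
  Y y /\ forall y', Y y' -> g y' <= g y.

(* The joint actions of the rounds played so far, most recent round first: the
   history after rounds 1, ..., t is [:: a_t; ...; a_1]. *)
Definition history (d1 d2 : nat) : Type := seq ('I_d1 * 'I_d2).

(* An adaptive adversary [adv] and the players' mixed strategies [xs], [ys] are
   functions of the history: the objects A_t, x_t, y_t of round t are [adv h],
   [xs h], [ys h], with h the history of the rounds before t.  In particular
   A_t does not depend on the actions sampled in round t. *)

Definition estimator (R : realType) (d1 d2 : nat) (A : 'M[R]_(d1, d2))
    (x : 'cV[R]_d1) (y : 'cV[R]_d2) (i : 'I_d1) (j : 'I_d2) : 'M[R]_(d1, d2) :=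
  (A i j / (x i 0 * y j 0)) *: delta_mx i j.

Definition reg_loss (R : realType) (d1 d2 : nat) (eta : R)
    (Ahat : 'M[R]_(d1, d2)) (x : 'cV[R]_d1) (y : 'cV[R]_d2) : R :=
  bilin x Ahat y + eta^-1 * neg_entropy x - eta^-1 * neg_entropy y.

(* The sum of the regularized losses of all the rounds recorded in [h]. *)
Fixpoint cum_loss (R : realType) (d1 d2 : nat) (eta : R)
    (adv : history d1 d2 -> 'M[R]_(d1, d2))
    (xs : history d1 d2 -> 'cV[R]_d1) (ys : history d1 d2 -> 'cV[R]_d2)
    (h : history d1 d2) (x : 'cV[R]_d1) (y : 'cV[R]_d2) : R :=
  if h is (i, j) :: h' then
    cum_loss eta adv xs ys h' x y
    + reg_loss eta (estimator (adv h') (xs h') (ys h') i j) x y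
  else 0.

Definition bandit_omg_rftl (R : realType) (d1 d2 : nat) (eta delta : R)
    (adv : history d1 d2 -> 'M[R]_(d1, d2))
    (xs : history d1 d2 -> 'cV[R]_d1)
    (ys : history d1 d2 -> 'cV[R]_d2) : Prop :=
  [/\ tsimplex delta (xs [::]),
      tsimplex delta (ys [::]),
      forall h : history d1 d2, h <> [::] ->
        is_argmin (tsimplex delta)
          (fun x => max_over (tsimplex delta)
             (fun y => cum_loss eta adv xs ys h x y)) (xs h)
    & forall h : history d1 d2, h <> [::] ->
        is_argmax (tsimplex delta)
          (fun y => min_over (tsimplex delta)
             (fun x => cum_loss eta adv xs ys h x y)) (ys h)].

(* Rounds are numbered from 0: [I t], [J t] are the indices of the unit vectors
   sampled in round t+1, and [past I J t] is the history of the t rounds before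
   it. *)
Fixpoint past (Omega : Type) (d1 d2 : nat) (I : nat -> Omega -> 'I_d1)
    (J : nat -> Omega -> 'I_d2) (t : nat) (w : Omega) : history d1 d2 :=
  if t is s.+1 then (I s w, J s w) :: past I J s w else [::].

(* Given any history of the previous rounds, the two actions of a round are
   conditionally independent with laws [xs h] and [ys h]; the identity is stated
   without division by the probability of the history. *)
Definition sampled_from (R : realType) (disp : measure_display)
    (Omega : measurableType disp) (P : probability Omega R) (d1 d2 T : nat)
    (xs : history d1 d2 -> 'cV[R]_d1) (ys : history d1 d2 -> 'cV[R]_d2)
    (I : nat -> Omega -> 'I_d1) (J : nat -> Omega -> 'I_d2) : Prop :=
  [/\ forall t i, (t < T)%N -> measurable [set w | I t w = i],
      forall t j, (t < T)%N -> measurable [set w | J t w = j]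
    & forall t (h : history d1 d2) i j, (t < T)%N ->
        P [set w | [/\ past I J t w = h, I t w = i & J t w = j]] =
        (P [set w | past I J t w = h] * (xs h i 0 * ys h j 0)%:E)%E].

Definition nash_regret (R : realType) (Omega : Type) (d1 d2 T : nat)
    (adv : history d1 d2 -> 'M[R]_(d1, d2))
    (I : nat -> Omega -> 'I_d1) (J : nat -> Omega -> 'I_d2) (w : Omega) : R :=
  \sum_(t < T)
     bilin (unit_vec R (I t w)) (adv (past I J t w)) (unit_vec R (J t w))
  - min_over (@simplex R d1) (fun x => max_over (@simplex R d2) (fun y =>
      \sum_(t < T) bilin x (adv (past I J t w)) y)).

(* Main.v *)
(* With s = 1/delta = eta one has T = s^6, and the realized payoff of round t is
   x_t^T Ahat_t y_t exactly. The algorithm is follow-the-leader for saddle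
   points: (x_(t+1), y_(t+1)) is a saddle point of the sum F_t of the first t
   losses, which is strongly convex-concave with modulus of order t/s because
   every round adds an entropy term. Comparing F_t with F_(t-1) at their saddle
   points z_(t+1) and z_t shows that the value increases by x_t^T Ahat_t y_t up
   to the entropy and |Ahat_t| |z_(t+1) - z_t|, and that
   |z_(t+1) - z_t| = O(s^3 / t); as |Ahat_t| <= s^2, these errors add up to
   O(s^5 ln T). The value of F_T differs from the min-max of the sum of the A_t
   by the truncation error 2 (d1 + d2) delta T, the entropy (d1 + d2) T / s and
   the l^1 norm of the matrix martingale sum (A_t - Ahat_t), whose entries have
   second moment at most T s^2 = s^8. *)
Require Import Defs.
From mathcomp Require Import all_boot all_order all_algebra.
From mathcomp Require Import all_classical all_reals all_analysis.
From mathcomp Require Import ring lra.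

Set Implicit Arguments.
Unset Strict Implicit.
Unset Printing Implicit Defensive.

Import Order.TTheory GRing.Theory Num.Theory.

Local Open Scope classical_set_scope.
Local Open Scope ring_scope.

(** * Entropy on the truncated simplex *)

Lemma ln_le_subr1 (R : realType) (x : R) : 0 < x -> ln x <= x - 1.
Proof.
move=> x0; have := @le_ln1Dx R (x - 1).
by rewrite subrKC; apply; lra.
Qed.

(** A tangent line plus a quadratic gain: the gain yields strong convexity of the entropy, and the
    tangent line alone yields its Lipschitz bound. *)
Lemma xlnx_tangent (R : realType) (a m : R) :
  0 < a <= 1 -> 0 < m <= 1 ->
  m * ln m + (1 + ln m) * (a - m) + (a - m) ^+ 2 / 4 <= a * ln a.
Proof.
move=> /andP[a0 a1] /andP[m0 m1].
(* [ln y <= y - 1] at [y = sqrt (m / a)] bounds the divergence below by the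
   Hellinger distance [(sqrt a - sqrt m)^2]. *)
pose p := Num.sqrt a; pose q := Num.sqrt m.
have p0 : 0 < p by rewrite sqrtr_gt0.
have q0 : 0 < q by rewrite sqrtr_gt0.
have pE : a = p ^+ 2 by rewrite sqr_sqrtr // ltW.
have qE : m = q ^+ 2 by rewrite sqr_sqrtr // ltW.
have p1 : p <= 1 by rewrite -sqrtr1 ler_wsqrtr.
have q1 : q <= 1 by rewrite -sqrtr1 ler_wsqrtr.
have := @ln_le_subr1 R (q / p) (divr_gt0 q0 p0).
rewrite ln_div ?posrE // => H.
rewrite pE qE !lnXn // !mulr2n.
have {}H : p * (ln q - ln p) <= q - p.
  have -> : q - p = p * (q / p - 1) by field; rewrite gt_eqF.
  by rewrite ler_pM2l.
have H2 : p ^+ 2 * (ln q - ln p) <= p * (q - p).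
  by rewrite expr2 -mulrA ler_pM2l.
(* The factor [(p + q) / 2] is at most 1 because [a] and [m] are; this fixes the constant 1/4. *)
have H3 : (p ^+ 2 - q ^+ 2) ^+ 2 / 4 <= (p - q) ^+ 2.
  have -> : (p ^+ 2 - q ^+ 2) ^+ 2 / 4 = (p - q) ^+ 2 * ((p + q) / 2) ^+ 2.
    by field.
  rewrite ler_piMr ?sqr_ge0 // expr_le1 //; lra.
lra.
Qed.

Lemma tsimplexP {R : realType} {d : nat} {delta : R} {x : 'cV[R]_d} :
  0 < delta ->
  tsimplex delta x <-> (forall i, delta <= x i 0) /\ \sum_i x i 0 = 1.
Proof.
move=> d0; split=> [[[x0 x1] xd]|[xd x1]].
  by split=> //; rewrite -x1; apply: eq_bigr => i _; rewrite ger0_norm.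
have x0 i : 0 <= x i 0 by apply: le_trans (xd i); exact: ltW.
split=> //; split=> //; rewrite -x1.
by apply: eq_bigr => i _; rewrite ger0_norm.
Qed.

Lemma simplexP {R : realType} {d : nat} {x : 'cV[R]_d} :
  simplex x <-> (forall i, 0 <= x i 0) /\ \sum_i x i 0 = 1.
Proof.
split=> -[x0 x1]; split=> //; rewrite -x1; apply: eq_bigr => i _.
  by rewrite ger0_norm.
by rewrite ger0_norm.
Qed.

Lemma simplex_dim_gt0 (R : realType) (d : nat) (x : 'cV[R]_d) :
  simplex x -> (0 < d)%N.
Proof.
case: d x => // x [_]; rewrite big_ord0 => /eqP.
by rewrite eq_sym oner_eq0.
Qed.

Lemma simplex_le1 (R : realType) (d : nat) (x : 'cV[R]_d) i :
  simplex x -> 0 <= x i 0 <= 1.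
Proof.
move=> /simplexP[x0 x1]; rewrite x0 /= -x1 (bigD1 i) //= lerDl.
exact: sumr_ge0.
Qed.

Lemma tsimplex_le1 (R : realType) (d : nat) (delta : R) (x : 'cV[R]_d) i :
  0 < delta -> tsimplex delta x -> 0 < x i 0 <= 1.
Proof.
move=> d0 [sx xd]; have /andP[_ ->] := simplex_le1 i sx.
by rewrite (lt_le_trans d0).
Qed.

Lemma tsimplex_conv (R : realType) (d : nat) (delta l : R)
    (x y : 'cV[R]_d) : 0 < delta -> 0 <= l <= 1 ->
  tsimplex delta x -> tsimplex delta y ->
  tsimplex delta ((1 - l) *: x + l *: y).
Proof.
move=> d0 /andP[l0 l1] /(tsimplexP d0)[xd x1] /(tsimplexP d0)[yd y1].
apply/(tsimplexP d0); split=> [i|].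
  by rewrite !mxE; have := xd i; have := yd i; nra.
under eq_bigr do rewrite !mxE.
by rewrite big_split /= -!mulr_sumr x1 y1; lra.
Qed.

Definition sqnorm (R : realType) (d : nat) (x : 'cV[R]_d) : R :=
  \sum_i x i 0 ^+ 2.
Arguments sqnorm {R d}.

Lemma sqnorm_ge0 (R : realType) (d : nat) (x : 'cV[R]_d) : 0 <= sqnorm x.
Proof. by apply: sumr_ge0 => i _; exact: sqr_ge0. Qed.

Lemma sqnormN (R : realType) (d : nat) (x y : 'cV[R]_d) :
  sqnorm (x - y) = sqnorm (y - x).
Proof. by apply: eq_bigr => i _; rewrite !mxE; ring. Qed.

Lemma sqnorm_coord (R : realType) (d : nat) (x : 'cV[R]_d) i :
  `|x i 0| <= Num.sqrt (sqnorm x).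
Proof.
rewrite -sqrtr_sqr ler_wsqrtr // /sqnorm (bigD1 i) //= lerDl.
by apply: sumr_ge0 => j _; exact: sqr_ge0.
Qed.

(** The tangent inequality at the mixture is applied to both endpoints: the weighted linear terms
    cancel, and the squares combine through [(1 - l) * l ^+ 2 + l * (1 - l) ^+ 2 = l * (1 - l)]. *)
Lemma neg_entropy_conv (R : realType) (d : nat) (delta l : R)
    (x y : 'cV[R]_d) : 0 < delta -> 0 <= l <= 1 ->
  tsimplex delta x -> tsimplex delta y ->
  neg_entropy ((1 - l) *: x + l *: y) + l * (1 - l) / 4 * sqnorm (x - y) <=
  (1 - l) * neg_entropy x + l * neg_entropy y.
Proof.
move=> d0 l01 tx ty; have tm := tsimplex_conv d0 l01 tx ty.
rewrite /neg_entropy /sqnorm.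
set S := \sum_i _; set S1 := \sum_i _; set S2 := \sum_i _; set S3 := \sum_i _.
suff : S + l * (1 - l) / 4 * S1 <= (1 - l) * S2 + l * S3 by lra.
rewrite !mulr_sumr -!big_split; apply: ler_sum => i _ /=.
have := tsimplex_le1 i d0 tm; rewrite !mxE => mi.
have xm := xlnx_tangent (tsimplex_le1 i d0 tx) mi.
have ym := xlnx_tangent (tsimplex_le1 i d0 ty) mi.
move: l01 => /andP[l0 l1].
have l1' : 0 <= 1 - l by lra.
have := ler_wpM2l l1' xm; have := ler_wpM2l l0 ym.
lra.
Qed.

(** This is the Kullback-Leibler divergence from the uniform distribution; [ln z <= z - 1] at
    [z = 1 / (x i 0 * d%:R)] bounds it below by the sum of the [x i 0 - d%:R^-1], which is 0. *)
Lemma neg_entropy_ge0 (R : realType) (d : nat) (delta : R) (x : 'cV[R]_d) :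
  0 < delta -> tsimplex delta x -> 0 <= neg_entropy x.
Proof.
move=> d0 tx; have [_ x1] := (tsimplexP d0).1 tx.
have dn0 : 0 < d%:R :> R by rewrite ltr0n; exact: simplex_dim_gt0 tx.1.
have -> : neg_entropy x = \sum_i x i 0 * ln (x i 0 * d%:R).
  have -> : neg_entropy x = \sum_i (x i 0 * ln (x i 0) + x i 0 * ln d%:R).
    by rewrite big_split /= -mulr_suml x1 mul1r.
  apply: eq_bigr => i _; have /andP[xi _] := tsimplex_le1 i d0 tx.
  by rewrite lnM ?posrE // mulrDr.
have E : \sum_i (x i 0 - d%:R^-1) = 0.
  rewrite sumrB x1 sumr_const card_ord -[_ *+ d]mulr_natr mulVf ?subrr //.
  exact: lt0r_neq0.
rewrite -[leLHS]E; apply: ler_sum => i _.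
have /andP[xi _] := tsimplex_le1 i d0 tx.
have p0 : 0 < x i 0 * d%:R by rewrite mulr_gt0.
have := ln_le_subr1 (divr_gt0 ltr01 p0).
rewrite div1r lnV ?posrE // => H.
have := ler_wpM2l (ltW xi) H.
suff -> : x i 0 * ((x i 0 * d%:R)^-1 - 1) = d%:R^-1 - x i 0 by lra.
by field; rewrite !gt_eqF.
Qed.

Lemma neg_entropy_le (R : realType) (d : nat) (delta : R) (x : 'cV[R]_d) :
  0 < delta -> tsimplex delta x -> neg_entropy x <= d%:R.
Proof.
move=> d0 tx; rewrite /neg_entropy.
have : \sum_i x i 0 * ln (x i 0) <= 0.
  apply: sumr_le0 => i _; have /andP[xi x1] := tsimplex_le1 i d0 tx.
  by rewrite mulr_ge0_le0 ?ln_le0 // ltW.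
have : ln d%:R <= d%:R :> R.
  have [d00|d00] := leqP d 0.
    by move: d00; rewrite leqn0 => /eqP->; rewrite ln0.
  by have := @ln_le_subr1 R d%:R; rewrite ltr0n d00 => /(_ isT); lra.
lra.
Qed.

(** The 1 in the derivative [1 + ln (x i 0)] drops out, as the coordinate differences of two points
    of the simplex sum to 0; the logarithm is at most [delta^-1] in absolute value after
    truncation. *)
Lemma neg_entropy_lip (R : realType) (d : nat) (delta : R) (x y : 'cV[R]_d) :
  0 < delta -> tsimplex delta x -> tsimplex delta y ->
  neg_entropy x - neg_entropy y <=
  d%:R / delta * Num.sqrt (sqnorm (x - y)).
Proof.
move=> d0 tx ty; rewrite /neg_entropy.
have [_ x1] := (tsimplexP d0).1 tx; have [_ y1] := (tsimplexP d0).1 ty.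
set N := Num.sqrt _.
have -> : d%:R / delta * N = \sum_(i < d) (x i 0 - y i 0 + delta^-1 * N).
  rewrite big_split /= sumrB x1 y1 subrr add0r sumr_const card_ord.
  by rewrite -[RHS]mulr_natl mulrA.
suff : \sum_i x i 0 * ln (x i 0) - \sum_i y i 0 * ln (y i 0) <=
       \sum_(i < d) (x i 0 - y i 0 + delta^-1 * N) by lra.
rewrite -sumrB; apply: ler_sum => i _.
have /andP[xi xi1] := tsimplex_le1 i d0 tx.
have T := xlnx_tangent (tsimplex_le1 i d0 ty) (tsimplex_le1 i d0 tx).
have sq := sqr_ge0 (y i 0 - x i 0).
suff : ln (x i 0) * (x i 0 - y i 0) <= delta^-1 * N by lra.
have xN : `|x i 0 - y i 0| <= N.
  by have := @sqnorm_coord _ _ (x - y) i; rewrite !mxE.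
apply: le_trans (ler_norm _) _; rewrite normrM ler_pM //.
rewrite ler0_norm ?ln_le0 //.
have := ln_le_subr1 (divr_gt0 ltr01 xi); rewrite div1r lnV ?posrE //.
have : (x i 0)^-1 <= delta^-1 by rewrite lef_pV2 ?posrE //; exact: tx.2.
lra.
Qed.

(** * Saddle points *)

Section SupInf.
Context {R : realType} {U : Type}.
Implicit Types (X : set U) (g : U -> R).

Lemma max_over_ge X g K x :
  (forall y, X y -> g y <= K) -> X x -> g x <= max_over X g.
Proof.
move=> gK Xx; apply: ub_le_sup; last by exists x.
by exists K => _ [y Xy <-]; exact: gK.
Qed.

Lemma max_over_le X g K x :
  X x -> (forall y, X y -> g y <= K) -> max_over X g <= K.
Proof.
move=> Xx gK; apply: ge_sup; first by exists (g x), x.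
by move=> _ [y Xy <-]; exact: gK.
Qed.

Lemma max_over_adherent X g K e x : X x -> (forall y, X y -> g y <= K) ->
  0 < e -> exists2 y, X y & max_over X g - e <= g y.
Proof.
move=> Xx gK e0.
have [|_ [y Xy <-] h] := @sup_adherent R [set g y | y in X] e e0.
  by split; [exists (g x), x|exists K => _ [y Xy <-]; exact: gK].
by exists y => //; exact: ltW.
Qed.

Lemma min_over_le X g K x :
  (forall y, X y -> K <= g y) -> X x -> min_over X g <= g x.
Proof.
move=> gK Xx; apply: ge_inf; last by exists x.
by exists K => _ [y Xy <-]; exact: gK.
Qed.

Lemma min_over_ge X g K x :
  X x -> (forall y, X y -> K <= g y) -> K <= min_over X g.
Proof.
move=> Xx gK; apply: lb_le_inf; first by exists (g x), x.
by move=> _ [y Xy <-]; exact: gK.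
Qed.

End SupInf.

Definition saddle (R : realType) (U V : Type) (X : set U) (Y : set V)
    (F : U -> V -> R) (x : U) (y : V) : Prop :=
  [/\ X x, Y y, forall x', X x' -> F x y <= F x' y &
      forall y', Y y' -> F x y' <= F x y].

(* Existence of maximizers is not needed: for [z] close to [xs] on the way to
   [x], an approximate maximizer of [F z] also nearly maximizes [F xs], hence by
   strong concavity it is close to a fixed approximate maximizer [y0] of [F xs];
   convexity in [x] along the segment then gives [max F xs <= F x y0 + e]. *)
Lemma minimax_saddle (R : realType) (U V : Type) (X : set U) (Y : set V)
    (F : U -> V -> R) (q : V -> V -> R) (K c : R) (xs : U) (ys : V) :
  0 < c ->
  (forall x y, X x -> Y y -> `|F x y| <= K) ->
  (forall l x x', 0 <= l <= 1 -> X x -> X x' -> exists2 z, X z &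
     forall y, Y y -> F z y <= (1 - l) * F x y + l * F x' y) ->
  (forall y y', Y y -> Y y' -> exists2 z, Y z &
     forall x, X x -> (F x y + F x y') / 2 + c * q y y' <= F x z) ->
  (forall e, 0 < e -> exists2 r, 0 < r & forall x y y', X x -> Y y -> Y y' ->
     q y y' <= r -> F x y' <= F x y + e) ->
  is_argmin X (fun x => max_over Y (F x)) xs ->
  is_argmax Y (fun y => min_over X (fun x => F x y)) ys ->
  saddle X Y F xs ys.
Proof.
move=> c0 bF convF concF ucF [Xs minF] [Ys maxF].
have ub x : X x -> forall y, Y y -> F x y <= K.
  by move=> Xx y Yy; have := bF x y Xx Yy; rewrite ler_norml => /andP[].
have lb y : Y y -> forall x, X x -> - K <= F x y.
  by move=> Yy x Xx; have := bF x y Xx Yy; rewrite ler_norml => /andP[].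
have K0 : 0 <= K by apply: le_trans (bF xs ys Xs Ys).
have key e : 0 < e -> exists2 y0, Y y0 &
    forall x, X x -> max_over Y (F xs) <= F x y0 + e.
  move=> e0; have e20 : 0 < e / 2 by lra.
  have [r r0 ucr] := ucF _ e20.
  have cr0 : 0 < c * r by rewrite mulr_gt0.
  have [y0 Y0 hy0] := max_over_adherent Ys (ub xs Xs) cr0.
  exists y0 => // x Xx.
  (* [y0] misses the maximum of [F xs] by at most [c * r], and [yl] by at most
     [l * (e / 2 + 2 * K)]. With [l * D = c * r] the second gap is at most [c * r] too, so strong
     concavity forces [q y0 yl <= r]; the summand [c * r] in [D] keeps [l <= 1]. *)
  pose D := e / 2 + 2 * K + c * r.
  have D0 : 0 < D by rewrite /D; lra.
  pose l := c * r / D.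
  have l0 : 0 < l by rewrite divr_gt0.
  have l1 : l <= 1 by rewrite ler_pdivrMr // /D; lra.
  have lD : l * D = c * r by rewrite /l divfK // gt_eqF.
  have l01 : 0 <= l <= 1 by rewrite l1 ltW.
  have [xl Xl hl] := convF l xs x l01 Xs Xx.
  have le0 : 0 < l * (e / 2) by rewrite mulr_gt0.
  have [yl Yl hyl] :=
    max_over_adherent Ys (ub xl Xl) le0.
  have m1 := minF xl Xl.
  have m2 := hl yl Yl.
  have m3 := max_over_ge (ub xs Xs) Yl.
  have [ym Ym hm] := concF y0 yl Y0 Yl.
  have m4 := hm xs Xs.
  have m5 := max_over_ge (ub xs Xs) Ym.
  have b1 := ub x Xx yl Yl.
  have b2 := lb yl Yl xs Xs.
  set v := max_over Y (F xs) in hy0 m1 m3 m5 *.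
  (* Minimality of [xs] compares [v] with the maximum at [xl]; convexity along the segment leaves
     [l * v] on the left, and [l] is divided out. *)
  have h1 : v <= F x yl + e / 2.
    have : (1 - l) * F xs yl <= (1 - l) * v by rewrite ler_wpM2l //; lra.
    move=> h; have : l * v <= l * (F x yl + e / 2) by lra.
    by rewrite ler_pM2l.
  have h2 : q y0 yl <= r.
    have h3 : v - l * (e / 2 + 2 * K) <= F xs yl.
      have : l * (F x yl - F xs yl) <= l * (2 * K) by rewrite ler_wpM2l //; lra.
      by lra.
    have h4 : 0 <= l * (c * r) by rewrite mulr_ge0 // ltW.
    have : c * q y0 yl <= c * r by rewrite /D in lD; lra.
    by rewrite ler_pM2l.
  by have := ucr x y0 yl Xx Y0 Yl h2; lra.
(* By [key] and the maximality of [ys], the min-max does not exceed the max-min. Setting [x = xs] or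
   [y = ys] then gives the two saddle inequalities. *)
have main x y : X x -> Y y -> F xs y <= F x ys.
  move=> Xx Yy; apply/ler_addgt0Pr => e e0.
  have [y0 Y0 h] := key e e0.
  have m1 := max_over_ge (ub xs Xs) Yy.
  have m2 := min_over_le (lb ys Ys) Xx.
  have m3 := maxF y0 Y0.
  have : max_over Y (F xs) - e <= min_over X (fun x => F x y0).
    by apply: min_over_ge Xs _ => x' Xx'; have := h x' Xx'; lra.
  move=> m4; apply: le_trans m1 _.
  by move: m2 => /= m2; lra.
by split=> // z Zz; exact: main.
Qed.

(** * Bilinear payoffs *)

Section Bilin.
Context {R : realType} {d1 d2 : nat}.
Implicit Types (x u : 'cV[R]_d1) (y v : 'cV[R]_d2) (A B : 'M[R]_(d1, d2)).

Lemma bilinE x A y : bilin x A y = \sum_i \sum_j x i 0 * A i j * y j 0.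
Proof.
rewrite /bilin mxE exchange_big /=; apply: eq_bigr => j _.
by rewrite mxE mulr_suml; apply: eq_bigr => i _; rewrite mxE.
Qed.

Lemma bilinDl x u A y : bilin (x + u) A y = bilin x A y + bilin u A y.
Proof. by rewrite /bilin linearD /= !mulmxDl mxE. Qed.

Lemma bilinZl l x A y : bilin (l *: x) A y = l * bilin x A y.
Proof. by rewrite /bilin linearZ /= -!scalemxAl mxE. Qed.

Lemma bilinDr x A y v : bilin x A (y + v) = bilin x A y + bilin x A v.
Proof. by rewrite /bilin mulmxDr mxE. Qed.

Lemma bilinZr l x A y : bilin x A (l *: y) = l * bilin x A y.
Proof. by rewrite /bilin -!scalemxAr mxE. Qed.

Lemma bilinNr x A y : bilin x A (- y) = - bilin x A y.
Proof. by rewrite -scaleN1r bilinZr mulN1r. Qed.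

Lemma bilinD x A B y : bilin x (A + B) y = bilin x A y + bilin x B y.
Proof. by rewrite /bilin mulmxDr mulmxDl mxE. Qed.

Lemma bilinN x A y : bilin x (- A) y = - bilin x A y.
Proof. by rewrite /bilin mulmxN mulNmx mxE. Qed.

Lemma bilin0 x y : bilin x 0 y = 0.
Proof. by rewrite /bilin mulmx0 mul0mx mxE. Qed.

Lemma bilin_delta x (a : R) i j y :
  bilin x (a *: delta_mx i j) y = a * (x i 0 * y j 0).
Proof.
rewrite bilinE (bigD1 i) //= (bigD1 j) //= !mxE !eqxx /= mulr1.
rewrite big1 ?addr0 => [|j' jj']; last first.
  by rewrite !mxE (negbTE jj') andbF !mulr0 mul0r.
rewrite big1 ?addr0 => [|i' ii']; first by ring.
by rewrite big1 // => j' _; rewrite !mxE (negbTE ii') !mulr0 mul0r.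
Qed.

Lemma bilin_unit (i : 'I_d1) A (j : 'I_d2) :
  bilin (unit_vec R i) A (unit_vec R j) = A i j.
Proof.
rewrite bilinE (bigD1 i) //= (bigD1 j) //= !mxE !eqxx /= mulr1 mul1r.
rewrite big1 ?addr0 => [|j' jj']; last by rewrite !mxE (negbTE jj') mulr0.
rewrite big1 ?addr0 // => i' ii'.
by rewrite big1 // => j' _; rewrite !mxE (negbTE ii') !mul0r.
Qed.

Lemma bilin_norm_le x A y (a b : R) :
  (forall i, `|x i 0| <= a) -> (forall j, `|y j 0| <= b) ->
  `|bilin x A y| <= a * b * \sum_i \sum_j `|A i j|.
Proof.
move=> xa yb; rewrite bilinE mulr_sumr.
apply: le_trans (ler_norm_sum _ _ _) _; apply: ler_sum => i _.
rewrite mulr_sumr.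
apply: le_trans (ler_norm_sum _ _ _) _; apply: ler_sum => j _.
by rewrite !normrM mulrAC ler_wpM2r // ler_pM.
Qed.

Lemma bilin_simplex_le x A y : simplex x -> simplex y ->
  `|bilin x A y| <= \sum_i \sum_j `|A i j|.
Proof.
move=> sx sy; rewrite -[leRHS]mul1r -[X in X * _]mulr1.
by apply: bilin_norm_le => i;
  [have := simplex_le1 i sx|have := simplex_le1 i sy];
  move=> /andP[h0 h1]; rewrite ger0_norm.
Qed.

End Bilin.

Lemma bilin_tr {R : realType} {d1 d2 : nat} (x : 'cV[R]_d1)
    (A : 'M[R]_(d1, d2)) (y : 'cV[R]_d2) : bilin y A^T x = bilin x A y.
Proof.
rewrite !bilinE exchange_big /=; apply: eq_bigr => i _.
by apply: eq_bigr => j _; rewrite mxE; ring.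
Qed.

(** * Entropy-regularized matrix games *)

Definition ent_loss (R : realType) (d1 d2 : nat) (c : R)
    (B : 'M[R]_(d1, d2)) (x : 'cV[R]_d1) (y : 'cV[R]_d2) : R :=
  bilin x B y + c * (neg_entropy x - neg_entropy y).

Notation ent_saddle delta c B :=
  (saddle (tsimplex delta) (tsimplex delta) (ent_loss c B)).

(** Exchanging the players turns the game of [B] into that of [- B^T], so each estimate in [x] is
    also one in [y]. *)
Lemma ent_lossN (R : realType) (d1 d2 : nat) (c : R)
    (B : 'M[R]_(d1, d2)) x y : ent_loss c (- B^T) y x = - ent_loss c B x y.
Proof. by rewrite /ent_loss bilinN bilin_tr; ring. Qed.

Lemma ent_saddle_swap (R : realType) (d1 d2 : nat) (delta c : R)
    (B : 'M[R]_(d1, d2)) x y :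
  ent_saddle delta c B x y -> ent_saddle delta c (- B^T) y x.
Proof.
move=> [tx ty hx hy]; split=> // z tz; rewrite !ent_lossN lerN2.
  exact: hy.
exact: hx.
Qed.

Section EntLoss.
Context {R : realType} {d1 d2 : nat}.
Variables (delta c : R) (B : 'M[R]_(d1, d2)).
Hypotheses (d0 : 0 < delta) (c0 : 0 <= c).

Lemma ent_loss_convl (l : R) (x x' : 'cV[R]_d1) y :
  0 <= l <= 1 -> tsimplex delta x -> tsimplex delta x' ->
  ent_loss c B ((1 - l) *: x + l *: x') y +
    c * (l * (1 - l) / 4 * sqnorm (x - x'))
  <= (1 - l) * ent_loss c B x y + l * ent_loss c B x' y.
Proof.
move=> l01 tx tx'; rewrite /ent_loss bilinDl !bilinZl.
have := ler_wpM2l c0 (neg_entropy_conv d0 l01 tx tx').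
lra.
Qed.

(** Minimality is used against the midpoint of [x] and [x'], where strong convexity gains [c / 16];
    doubling gives [c / 8]. *)
Lemma ent_saddle_growth x y x' : ent_saddle delta c B x y ->
  tsimplex delta x' ->
  ent_loss c B x y + c / 8 * sqnorm (x - x') <= ent_loss c B x' y.
Proof.
move=> [tx ty hx _] tx'.
have l01 : 0 <= (1 / 2 : R) <= 1 by lra.
have := hx _ (tsimplex_conv d0 l01 tx tx').
have := ent_loss_convl y l01 tx tx'.
lra.
Qed.

End EntLoss.

Lemma ent_loss_bound (R : realType) (d1 d2 : nat) (delta c : R)
    (B : 'M[R]_(d1, d2)) x y : 0 < delta -> 0 <= c ->
  tsimplex delta x -> tsimplex delta y ->
  `|ent_loss c B x y| <= \sum_i \sum_j `|B i j| + c * (d1%:R + d2%:R).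
Proof.
move=> d0 c0 tx ty; apply: le_trans (ler_normD _ _) _.
rewrite lerD //; first by apply: bilin_simplex_le; [exact: tx.1|exact: ty.1].
rewrite normrM ger0_norm // ler_wpM2l // ler_norml.
have := neg_entropy_ge0 d0 tx; have := neg_entropy_ge0 d0 ty.
have := neg_entropy_le d0 tx; have := neg_entropy_le d0 ty.
have := ler0n R d1; have := ler0n R d2.
by move=> h1 h2 h3 h4 h5 h6; apply/andP; split; lra.
Qed.

Lemma ent_loss_lipr (R : realType) (d1 d2 : nat) (delta c : R)
    (B : 'M[R]_(d1, d2)) x y y' : 0 < delta -> 0 <= c ->
  tsimplex delta x -> tsimplex delta y -> tsimplex delta y' ->
  ent_loss c B x y' - ent_loss c B x y <=
  (\sum_i \sum_j `|B i j| + c * (d2%:R / delta)) * Num.sqrt (sqnorm (y - y')).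
Proof.
move=> d0 c0 tx ty ty'.
have h1 := ler_wpM2l c0 (neg_entropy_lip d0 ty ty').
have : `|bilin x B (y' - y)| <=
    1 * Num.sqrt (sqnorm (y' - y)) * \sum_i \sum_j `|B i j|.
  apply: bilin_norm_le => [i|j]; last exact: sqnorm_coord.
  by have /andP[h0 ?] := simplex_le1 i tx.1; rewrite ger0_norm.
rewrite sqnormN bilinDr bilinNr ler_norml => /andP[_ h2].
rewrite /ent_loss; lra.
Qed.

Lemma ent_saddle_exists (R : realType) (d1 d2 : nat) (delta c : R)
    (B : 'M[R]_(d1, d2)) x y : 0 < delta -> 0 < c ->
  is_argmin (tsimplex delta)
    (fun x => max_over (tsimplex delta) (ent_loss c B x)) x ->
  is_argmax (tsimplex delta)
    (fun y => min_over (tsimplex delta) (fun x => ent_loss c B x y)) y ->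
  ent_saddle delta c B x y.
Proof.
move=> d0 c0; have c0' := ltW c0.
(* The modulus [c / 16] is the strong concavity gain at a midpoint. *)
apply: (@minimax_saddle _ _ _ _ _ (ent_loss c B) (fun y y' => sqnorm (y - y'))
  (\sum_i \sum_j `|B i j| + c * (d1%:R + d2%:R)) (c / 16)).
- by rewrite divr_gt0.
- by move=> x' y' tx ty; exact: (ent_loss_bound B d0 c0' tx ty).
- move=> l z z' l01 tz tz'; exists ((1 - l) *: z + l *: z').
    exact: tsimplex_conv.
  move=> y' ty'; have := ent_loss_convl B d0 c0' y' l01 tz tz'.
  have : 0 <= c * (l * (1 - l) / 4 * sqnorm (z - z')).
    by rewrite !mulr_ge0 ?sqnorm_ge0 //; lra.
  lra.
- move=> y1 y2 t1 t2.
  have l01 : 0 <= (1 / 2 : R) <= 1 by lra.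
  exists ((1 - 1 / 2) *: y1 + (1 / 2) *: y2); first exact: tsimplex_conv.
  move=> x' tx'; have := ent_loss_convl (- B^T) d0 c0' x' l01 t1 t2.
  by rewrite !ent_lossN; lra.
move=> e e0.
set L := \sum_i \sum_j `|B i j| + c * (d2%:R / delta).
have L0 : 0 <= L.
  apply: addr_ge0; last by rewrite mulr_ge0 // divr_ge0 // ltW.
  by apply: sumr_ge0 => i _; apply: sumr_ge0.
(* This radius for the squared distance means a distance [e / (L + 1)], over which the loss varies
   by at most [e]; the [+ 1] avoids a division by 0. *)
exists ((e / (L + 1)) ^+ 2).
  by rewrite exprn_gt0 // divr_gt0 //; lra.
move=> x' y1 y2 tx t1 t2 /ler_wsqrtr.
have eL : 0 <= e / (L + 1) by rewrite divr_ge0 //; lra.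
rewrite sqrtr_sqr ger0_norm // => h.
have := ent_loss_lipr B d0 c0' tx t1 t2; rewrite -/L => h1.
have h2 := ler_wpM2l L0 h.
have : L * (e / (L + 1)) <= e.
  rewrite mulrA ler_pdivrMr; last lra.
  by rewrite mulrC ler_wpM2l //; lra.
lra.
Qed.

(** Each saddle point is tested against the other, in both games and for both players. In the sum of
    the four growth inequalities only the difference of the two games survives, taken at [(x, y')]
    minus [(x', y)]. It is Lipschitz in the distance, so a quadratic lower bound meets a linear
    upper bound. *)
Lemma ent_saddle_stable (R : realType) (d1 d2 : nat) (delta c e a : R)
    (B : 'M[R]_(d1, d2)) i j x y x' y' : 0 < delta -> 0 <= c -> 0 < e ->
  ent_saddle delta c B x y ->
  ent_saddle delta (c + e) (B + a *: delta_mx i j) x' y' ->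
  (2 * c + e) / 8 * Num.sqrt (sqnorm (x - x') + sqnorm (y - y')) <=
  2 * `|a| + e * (d1%:R + d2%:R) / delta.
Proof.
move=> d0 c0 e0 s0 s1; set n := Num.sqrt _.
have [tx ty _ _] := s0; have [tx' ty' _ _] := s1.
have ce0 : 0 <= c + e by lra.
have g1 := ent_saddle_growth d0 c0 s0 tx'.
have g2 := ent_saddle_growth d0 c0 (ent_saddle_swap s0) ty'.
have g3 := ent_saddle_growth d0 ce0 s1 tx.
have g4 := ent_saddle_growth d0 ce0 (ent_saddle_swap s1) ty.
rewrite !ent_lossN in g2 g4.
rewrite (sqnormN x' x) in g3; rewrite (sqnormN y' y) in g4.
have l1 := neg_entropy_lip d0 tx tx'; have l2 := neg_entropy_lip d0 ty ty'.
have qx := sqnorm_ge0 (x - x'); have qy := sqnorm_ge0 (y - y').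
have nx : Num.sqrt (sqnorm (x - x')) <= n by rewrite ler_wsqrtr //; lra.
have ny : Num.sqrt (sqnorm (y - y')) <= n by rewrite ler_wsqrtr //; lra.
have nE : n * n = sqnorm (x - x') + sqnorm (y - y').
  by rewrite -expr2 sqr_sqrtr //; lra.
have n0 : 0 <= n by rewrite sqrtr_ge0.
have cx : `|x i 0 - x' i 0| <= n.
  by apply: le_trans nx; have := sqnorm_coord (x - x') i; rewrite !mxE.
have cy : `|y j 0 - y' j 0| <= n.
  by apply: le_trans ny; have := sqnorm_coord (y - y') j; rewrite !mxE.
have k1 : a * (x i 0 * y' j 0 - x' i 0 * y j 0) <= `|a| * (2 * n).
  apply: le_trans (ler_norm _) _; rewrite normrM ler_wpM2l //.
  have -> : x i 0 * y' j 0 - x' i 0 * y j 0 =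
    (x i 0 - x' i 0) * y j 0 - x i 0 * (y j 0 - y' j 0) by ring.
  apply: le_trans (ler_normB _ _) _; rewrite !normrM.
  have /andP[_ x1] := tsimplex_le1 i d0 tx.
  have /andP[_ y1] := tsimplex_le1 j d0 ty.
  have /andP[x0 _] := simplex_le1 i tx.1.
  have /andP[y0 _] := simplex_le1 j ty.1.
  rewrite (ger0_norm x0) (ger0_norm y0).
  have h1 : `|x i 0 - x' i 0| * y j 0 <= n * 1 by rewrite ler_pM.
  have h2 : x i 0 * `|y j 0 - y' j 0| <= 1 * n by rewrite ler_pM.
  lra.
have k2 : e * (neg_entropy x - neg_entropy x') <= e * (d1%:R / delta * n).
  apply: ler_wpM2l; first exact: ltW.
  by apply: le_trans l1 _; rewrite ler_wpM2l // divr_ge0 // ltW.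
have k3 : e * (neg_entropy y - neg_entropy y') <= e * (d2%:R / delta * n).
  apply: ler_wpM2l; first exact: ltW.
  by apply: le_trans l2 _; rewrite ler_wpM2l // divr_ge0 // ltW.
have main : (2 * c + e) / 8 * n * n <=
            (2 * `|a| + e * (d1%:R + d2%:R) / delta) * n.
  rewrite -[_ * n * n]mulrA nE.
  rewrite /ent_loss !bilinD !bilin_delta in g1 g2 g3 g4.
  lra.
have [n00|/eqP n00] := eqVneq n 0.
  rewrite n00 mulr0 addr_ge0 ?mulr_ge0 ?invr_ge0 ?addr_ge0 //; exact: ltW.
by move: main; rewrite ler_pM2r // lt_def n0 andbT; exact/eqP.
Qed.

(** * Regret along a fixed history *)

(** Mix with the uniform distribution at weight [d2%:R * delta]: entry [j] moves by at most
    [d2%:R * delta * y j 0 + delta], and these amounts sum to [2 * delta * d2%:R]. *)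
Lemma simplex_truncate (R : realType) (d1 d2 : nat) (delta K : R)
    (A : 'M[R]_(d1, d2)) (y : 'cV[R]_d2) :
  0 < delta -> d2%:R * delta <= 1 -> (forall i j, `|A i j| <= K) ->
  simplex y -> exists2 y', tsimplex delta y' &
  forall x, simplex x -> `|bilin x A y - bilin x A y'| <= 2 * K * delta * d2%:R.
Proof.
move=> d0 dd1 AK sy; have [y0 y1] := (simplexP (x := y)).1 sy.
exists ((1 - d2%:R * delta) *: y + const_mx delta).
  apply/(tsimplexP d0); split=> [i|].
    by rewrite !mxE lerDr mulr_ge0 //; lra.
  under eq_bigr do rewrite !mxE.
  rewrite big_split /= -mulr_sumr y1 sumr_const card_ord -mulr_natl; ring.
move=> x sx; have [x0 x1] := (simplexP (x := x)).1 sx.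
rewrite !bilinE -sumrB.
apply: le_trans (ler_norm_sum _ _ _) _.
have -> : 2 * K * delta * d2%:R = \sum_i x i 0 * (2 * K * delta * d2%:R).
  by rewrite -mulr_suml x1 mul1r.
apply: ler_sum => i _.
rewrite -sumrB.
have -> : 2 * K * delta * d2%:R =
    \sum_j K * (d2%:R * delta * y j 0 + delta) :> R.
  rewrite -mulr_sumr big_split /= -mulr_sumr y1 sumr_const card_ord.
  by rewrite -[delta *+ _]mulr_natl; ring.
apply: le_trans (ler_norm_sum _ _ _) _.
rewrite mulr_sumr; apply: ler_sum => j _.
rewrite !mxE.
have -> : x i 0 * A i j * y j 0 -
    x i 0 * A i j * ((1 - d2%:R * delta) * y j 0 + delta) =
    x i 0 * (A i j * (d2%:R * delta * y j 0 - delta)) by ring.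
rewrite normrM (ger0_norm (x0 i)) ler_wpM2l // normrM ler_pM //.
have p : 0 <= d2%:R * delta * y j 0 by rewrite !mulr_ge0 // ltW.
rewrite ler_norml; apply/andP; split; lra.
Qed.

(** [y] bounds the inner maximum from below for every [x'], and [x] bounds the min-max from above.
    The saddle inequalities hold on truncated simplices, so each competitor is truncated first, at a
    cost of [2 * K * delta] per dimension; the entropy, between 0 and the dimension, costs [c] per
    dimension. *)
Lemma ent_saddle_minmax (R : realType) (d1 d2 : nat) (delta c K : R)
    (A B : 'M[R]_(d1, d2)) (x : 'cV[R]_d1) (y : 'cV[R]_d2) :
  0 < delta -> 0 <= c -> d1%:R * delta <= 1 -> d2%:R * delta <= 1 ->
  (forall i j, `|A i j| <= K) -> ent_saddle delta c B x y ->
  `|ent_loss c B x y - min_over (@simplex R d1) (fun x =>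
      max_over (@simplex R d2) (bilin x A))| <=
  \sum_i \sum_j `|(A - B) i j| + (c + 2 * K * delta) * (d1%:R + d2%:R).
Proof.
move=> d0 c0 dd1 dd2 AK [tx ty hx hy].
set M := \sum_i _; set v := ent_loss c B x y.
have AB x' y' : simplex x' -> simplex y' ->
    `|bilin x' A y' - bilin x' B y'| <= M.
  by move=> sx sy; rewrite -bilinN -bilinD; exact: bilin_simplex_le.
have ub x' : simplex x' -> forall y', simplex y' ->
    bilin x' A y' <= \sum_i \sum_j `|A i j|.
  move=> sx y' sy; apply: le_trans (ler_norm _) _.
  exact: bilin_simplex_le.
have ex := neg_entropy_ge0 d0 tx; have ey := neg_entropy_ge0 d0 ty.
have dp1 := ler0n R d1; have dp2 := ler0n R d2.
have cd1 : 0 <= c * d1%:R by rewrite mulr_ge0.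
have cd2 : 0 <= c * d2%:R by rewrite mulr_ge0.
have K0 : 0 <= K.
  apply: le_trans (AK (Ordinal (simplex_dim_gt0 tx.1))
                      (Ordinal (simplex_dim_gt0 ty.1))).
  exact: normr_ge0.
have kd1 : 0 <= K * delta * d1%:R by rewrite !mulr_ge0 // ltW.
have kd2 : 0 <= K * delta * d2%:R by rewrite !mulr_ge0 // ltW.
have low x' : simplex x' ->
  v - M - c * d1%:R - 2 * K * delta * d1%:R <=
    max_over (@simplex R d2) (bilin x' A).
  move=> sx.
  have := max_over_ge (ub x' sx) ty.1.
  have AK' i j : `|A^T i j| <= K by rewrite mxE.
  have [x2 tx2 /(_ _ ty.1)] := simplex_truncate d0 dd1 AK' sx.
  rewrite !bilin_tr ler_norml => /andP[h1 h2] h3.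
  have := AB _ _ tx2.1 ty.1; rewrite ler_norml => /andP[h4 h5].
  have := hx _ tx2; rewrite -/v /ent_loss => h6.
  have := ler_wpM2l c0 (neg_entropy_le d0 tx2).
  have := mulr_ge0 c0 ey.
  lra.
have up : max_over (@simplex R d2) (bilin x A) <=
    v + M + c * d2%:R + 2 * K * delta * d2%:R.
  apply: max_over_le ty.1 _ => y' sy.
  have [y2 ty2 /(_ _ tx.1)] := simplex_truncate d0 dd2 AK sy.
  rewrite ler_norml => /andP[h1 h2].
  have := AB _ _ tx.1 ty2.1; rewrite ler_norml => /andP[h4 h5].
  have := hy _ ty2; rewrite -/v /ent_loss => h6.
  have := ler_wpM2l c0 (neg_entropy_le d0 ty2).
  have := mulr_ge0 c0 ex.
  lra.
have m1 := min_over_le low tx.1.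
have m2 := min_over_ge tx.1 low.
rewrite /= in m1.
rewrite ler_norml; apply/andP; split; lra.
Qed.

Section Play.
Context {R : realType} {d1 d2 : nat}.
Variables (adv : history d1 d2 -> 'M[R]_(d1, d2)).
Variables (xs : history d1 d2 -> 'cV[R]_d1) (ys : history d1 d2 -> 'cV[R]_d2).
Implicit Types h : history d1 d2.

Fixpoint adv_sum h : 'M[R]_(d1, d2) :=
  if h is _ :: h' then adv_sum h' + adv h' else 0.

Fixpoint est_sum h : 'M[R]_(d1, d2) :=
  if h is (i, j) :: h' then
    est_sum h' + estimator (adv h') (xs h') (ys h') i j
  else 0.

Fixpoint payoff_sum h : R :=
  if h is (i, j) :: h' then payoff_sum h' + adv h' i j else 0.

Definition history_regret h : R :=
  payoff_sum h - min_over (@simplex R d1) (fun x =>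
    max_over (@simplex R d2) (bilin x (adv_sum h))).

(** The regret depends on the sample only through the final history, which reduces the theorem to
    fixed histories and a finite average. *)
Lemma nash_regretE T (Omega : Type) (I : nat -> Omega -> 'I_d1)
    (J : nat -> Omega -> 'I_d2) w :
  nash_regret T adv I J w = history_regret (past I J T w).
Proof.
rewrite /nash_regret /history_regret; congr (_ - _).
  elim: T => [|T IH]; first by rewrite big_ord0.
  by rewrite big_ord_recr /= IH bilin_unit.
congr (min_over _ _); apply: funext => x; congr (max_over _ _).
apply: funext => y.
elim: T => [|T IH]; first by rewrite big_ord0 bilin0.
by rewrite big_ord_recr /= IH bilinD.
Qed.

(** Every round adds entropy of weight [eta^-1] for each player, so the curvature of the game grows
    linearly with the number of rounds. *)
Lemma cum_lossE eta h x y : cum_loss eta adv xs ys h x y =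
  ent_loss ((size h)%:R * eta^-1) (est_sum h) x y.
Proof.
rewrite /ent_loss; elim: h => [|[i j] h IH] /=.
  by rewrite bilin0 !mul0r addr0.
by rewrite IH /reg_loss bilinD -natr1; ring.
Qed.

Variables (s : R) (T : nat).
Hypotheses (s1 : 1 <= s) (d1s : d1%:R <= s :> R) (d2s : d2%:R <= s :> R).
Hypothesis adv1 : forall h, (size h < T)%N -> forall i j, -1 <= adv h i j <= 1.
Hypothesis alg : bandit_omg_rftl s s^-1 adv xs ys.

Let s0 : 0 < s. Proof. exact: lt_le_trans s1. Qed.
Let delta0 : 0 < s^-1. Proof. by rewrite invr_gt0. Qed.

Lemma bandit_saddle h :
  ent_saddle s^-1 ((size h)%:R * s^-1) (est_sum h) (xs h) (ys h).
Proof.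
have [x0 y0 xh yh] := alg.
have [->|hN] := eqVneq h [::].
  (* Before the first round the loss is identically 0, so the arbitrary starting pair is a saddle
     point. *)
  by split=> // z _; rewrite /ent_loss !mul0r /= !bilin0 lexx.
have h0 : 0 < (size h)%:R * s^-1 :> R.
  by rewrite mulr_gt0 // ltr0n; case: h hN.
apply: ent_saddle_exists => //.
  have := xh h (elimN eqP hN); congr (is_argmin _ _ _).
  apply: funext => x; congr (max_over _ _); apply: funext => y.
  exact: cum_lossE.
have := yh h (elimN eqP hN); congr (is_argmax _ _ _).
apply: funext => y; congr (min_over _ _); apply: funext => x.
exact: cum_lossE.
Qed.

Lemma bandit_tsimplex h : tsimplex s^-1 (xs h) /\ tsimplex s^-1 (ys h).
Proof. by have [] := bandit_saddle h. Qed.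

(** The new value is at most the new loss at [(x, y')] and at least the new loss at [(x', y)]; in
    both, the old saddle inequalities compare the old part with the old value. The remaining
    estimator term differs from the realized payoff [a * (x i 0 * y j 0)] by the move of a single
    coordinate. *)
Lemma leader_regret h : (size h <= T)%N ->
  `|ent_loss ((size h)%:R * s^-1) (est_sum h) (xs h) (ys h) - payoff_sum h| <=
  32 * s ^+ 5 * \sum_(k < size h) k.+1%:R^-1 +
  (size h)%:R * s^-1 * (d1%:R + d2%:R).
Proof.
elim: h => [_|[i j] h IH /= hT].
  by rewrite /ent_loss /= bilin0 big_ord0 !mul0r !addr0 subrr normr0 mulr0.
have {IH} := IH (ltnW hT).
have S0 := bandit_saddle h; have S1 := bandit_saddle ((i, j) :: h).
rewrite [size _]/= [est_sum _]/= in S1.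
rewrite big_ord_recr /=.
have tE : (size h).+1%:R * s^-1 = (size h)%:R * s^-1 + s^-1.
  by rewrite -natr1 mulrDl mul1r.
rewrite tE in S1 *.
move: S0 S1; set x := xs h; set y := ys h; set x' := xs (_ :: h).
set y' := ys (_ :: h); set B := est_sum h; set H := \sum_(_ < _) _.
set t := size h; rewrite /estimator -/x -/y.
set a := (adv h i j / _) => S0 S1.
have t0 : 0 <= t%:R * s^-1 by rewrite mulr_ge0 // ltW.
have st := ent_saddle_stable delta0 t0 delta0 S0 S1.
have [tx ty hx hy] := S0; have [tx' ty' hx' hy'] := S1.
set n := Num.sqrt _ in st.
have /andP[xi0 xi1] := tsimplex_le1 i delta0 tx.
have /andP[yj0 yj1] := tsimplex_le1 j delta0 ty.
have aE : a * (x i 0 * y j 0) = adv h i j.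
  by rewrite /a divfK // mulf_neq0 // gt_eqF.
(* Truncation keeps both sampling probabilities at least [s^-1]. *)
have as2 : `|a| <= s ^+ 2.
  have A1 : `|adv h i j| <= 1 by rewrite ler_norml; exact: adv1.
  rewrite /a normrM -[leRHS]mul1r ler_pM // normfV gtr0_norm ?mulr_gt0 //.
  rewrite invfM expr2 ler_pM ?invr_ge0 //; try exact: ltW.
    by rewrite invf_ple ?posrE //; exact: tx.2.
  by rewrite invf_ple ?posrE //; exact: ty.2.
have n0 : 0 <= n by rewrite sqrtr_ge0.
clearbody a.
(* Stability bounds [(2 * t%:R + 1) * n] by [8 * s * (2 * s ^+ 2 + 2 * s)], hence by [32 * s ^+ 3].
   The [+ 1] is the curvature of the newest loss, so [t = 0] is covered as well. *)
have nt : s ^+ 2 * n <= 32 * s ^+ 5 * t.+1%:R^-1.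
  have e1 : (2 * t%:R + 1) * n <= 32 * s ^+ 3.
    have : 8 * s * ((2 * (t%:R * s^-1) + s^-1) / 8 * n) <=
           8 * s * (2 * `|a| + s^-1 * (d1%:R + d2%:R) / s^-1).
      by rewrite ler_wpM2l //; rewrite mulr_ge0 // ltW.
    have -> : 8 * s * ((2 * (t%:R * s^-1) + s^-1) / 8 * n) = (2 * t%:R + 1) * n.
      by field; rewrite gt_eqF.
    have -> : s^-1 * (d1%:R + d2%:R) / s^-1 = d1%:R + d2%:R :> R.
      by field; rewrite gt_eqF.
    move=> h1; apply: le_trans h1 _.
    have -> : 32 * s ^+ 3 = 8 * s * (4 * s ^+ 2) by ring.
    apply: ler_wpM2l; first by rewrite mulr_ge0 // ltW.
    have : s <= s ^+ 2 by rewrite expr2 ler_peMl // ltW.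
    have := d1s; have := d2s; lra.
  rewrite ler_pdivlMr ?ltr0n // -natr1.
  have e2 : 0 <= t%:R * n by rewrite mulr_ge0.
  have e3 : (t%:R + 1) * n <= 32 * s ^+ 3 by lra.
  have -> : s ^+ 2 * n * (t%:R + 1) = s ^+ 2 * ((t%:R + 1) * n) by ring.
  have -> : 32 * s ^+ 5 = s ^+ 2 * (32 * s ^+ 3) by ring.
  by rewrite ler_wpM2l // exprn_ge0 // ltW.
have bnd p q : 0 <= p <= 1 -> `|q| <= n -> `|a * (p * q)| <= s ^+ 2 * n.
  move=> /andP[p0 p1] qn; rewrite normrM ler_pM // normrM.
  by rewrite -[leRHS]mul1r ler_pM // ger0_norm.
have b1 : `|a * (x i 0 * (y' j 0 - y j 0))| <= s ^+ 2 * n.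
  apply: bnd; first by rewrite ltW.
  rewrite distrC.
  have := sqnorm_coord (y - y') j; rewrite !mxE => h1; apply: le_trans h1 _.
  by rewrite ler_wsqrtr // lerDr sqnorm_ge0.
have b2 : `|a * (y j 0 * (x' i 0 - x i 0))| <= s ^+ 2 * n.
  apply: bnd; first by rewrite ltW.
  rewrite distrC.
  have := sqnorm_coord (x - x') i; rewrite !mxE => h1; apply: le_trans h1 _.
  by rewrite ler_wsqrtr // lerDl sqnorm_ge0.
move: b1 b2; rewrite !ler_norml => /andP[b1 b1'] /andP[b2 b2'] /andP[I1 I2].
have u1 := hx' _ tx; have u2 := hy _ ty'.
have w1 := hy' _ ty; have w2 := hx _ tx'.
rewrite /ent_loss !bilinD !bilin_delta in I1 I2 u1 u2 w1 w2 *.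
have sp := ltW delta0.
have q1 := ler_wpM2l sp (neg_entropy_le delta0 tx).
have q2 := ler_wpM2l sp (neg_entropy_le delta0 ty).
have q3 := mulr_ge0 sp (neg_entropy_ge0 delta0 tx').
have q4 := mulr_ge0 sp (neg_entropy_ge0 delta0 ty').
have q5 : 0 <= s^-1 * d1%:R by rewrite mulr_ge0.
have q6 : 0 <= s^-1 * d2%:R by rewrite mulr_ge0.
move: (t.+1%:R^-1) nt => r nt.
apply/andP; split; lra.
Qed.

(** The entropy weight is [T%:R / s = s ^+ 5]. The factor 4 collects one [s ^+ 5] from the leader
    bound, one from the entropy and two from truncation, the entries of [adv_sum h] being at most
    [T%:R]. *)
Lemma history_regret_le h : T%:R = s ^+ 6 -> size h = T ->
  `|history_regret h| <=
  32 * s ^+ 5 * \sum_(k < T) k.+1%:R^-1 + 4 * s ^+ 5 * (d1%:R + d2%:R) +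
  \sum_i \sum_j `|(adv_sum h - est_sum h) i j|.
Proof.
move=> Ts hT.
have AT i j : `|adv_sum h i j| <= T%:R.
  rewrite -hT; have : (size h <= T)%N by rewrite hT.
  elim: h {hT} => [_|p h IH /= hT]; first by rewrite mxE normr0.
  rewrite mxE -natr1; apply: le_trans (ler_normD _ _) _.
  rewrite lerD ?IH ?(ltnW hT) // ler_norml; exact: adv1.
have hT' : (size h <= T)%N by rewrite hT.
have h1 : d1%:R * s^-1 <= 1 by rewrite ler_pdivrMr // mul1r.
have h2 : d2%:R * s^-1 <= 1 by rewrite ler_pdivrMr // mul1r.
have c0 : 0 <= (size h)%:R * s^-1 by rewrite mulr_ge0 // ltW.
have := ent_saddle_minmax delta0 c0 h1 h2 AT (bandit_saddle h).
have := leader_regret hT'.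
have e1 : (size h)%:R * s^-1 = s ^+ 5.
  by rewrite hT Ts; field; rewrite gt_eqF.
have e2 : 2 * T%:R * s^-1 = 2 * s ^+ 5 by rewrite Ts; field; rewrite gt_eqF.
rewrite e1 e2 hT /history_regret.
set v := ent_loss _ _ _ _; set m := min_over _ _.
rewrite !ler_norml => /andP[? ?] /andP[? ?]; apply/andP; split; lra.
Qed.

End Play.

(** * Expectation over histories *)

Section Mean.
Context {R : realType} {d1 d2 : nat}.
Variables (xs : history d1 d2 -> 'cV[R]_d1) (ys : history d1 d2 -> 'cV[R]_d2).
Implicit Types (h : history d1 d2) (f g : history d1 d2 -> R).

Fixpoint hist_prob h : R :=
  if h is (i, j) :: h' then hist_prob h' * (xs h' i 0 * ys h' j 0) else 1.

Fixpoint histories (t : nat) : seq (history d1 d2) :=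
  if t is t'.+1 then
    [seq p :: h | h <- histories t', p <- enum {: 'I_d1 * 'I_d2}]
  else [:: [::]].

(** The expectation over plays of [t] rounds as a finite sum, which keeps the martingale argument
    free of measure theory. *)
Definition mean (t : nat) f : R := \sum_(h <- histories t) hist_prob h * f h.

Lemma mem_histories t h : (h \in histories t) = (size h == t).
Proof.
elim: t h => [|t IH] [|p h] //.
  by apply/negbTE/negP => /allpairsP[[h' q] [_ _ /=]].
apply/allpairsP/idP => /= [[[h' q] [/= h't _ [_ ->]]]|].
  by rewrite eqSS -IH.
by rewrite eqSS -IH => ht; exists (h, p); rewrite mem_enum.
Qed.

Lemma histories_uniq t : uniq (histories t).
Proof.
elim: t => //= t IH; apply: allpairs_uniq => //; first exact: enum_uniq.
by move=> [h p] [h' p'] _ _ /= [-> ->].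
Qed.

(** The tower property: the last round is averaged first, conditionally on the earlier ones. *)
Lemma meanS t f : mean t.+1 f =
  mean t (fun h => \sum_p xs h p.1 0 * ys h p.2 0 * f (p :: h)).
Proof.
rewrite /mean /= big_allpairs_dep /=; apply: eq_bigr => h _.
rewrite mulr_sumr big_enum /=; apply: eq_bigr => -[i j] _ /=; ring.
Qed.

Lemma mean_add t f g : mean t (fun h => f h + g h) = mean t f + mean t g.
Proof. by rewrite /mean -big_split; apply: eq_bigr => h _; rewrite mulrDr. Qed.

Lemma mean_mull t (c : R) f : mean t (fun h => c * f h) = c * mean t f.
Proof. by rewrite /mean mulr_sumr; apply: eq_bigr => h _; ring. Qed.

Lemma mean_sum t (K : finType) (f : K -> history d1 d2 -> R) :
  mean t (fun h => \sum_k f k h) = \sum_k mean t (f k).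
Proof.
by rewrite /mean exchange_big; apply: eq_bigr => h _; rewrite mulr_sumr.
Qed.

Hypothesis xs_simplex : forall h, simplex (xs h).
Hypothesis ys_simplex : forall h, simplex (ys h).

Lemma hist_prob_ge0 h : 0 <= hist_prob h.
Proof.
elim: h => [|[i j] h IH] //=.
have /andP[xi _] := simplex_le1 i (xs_simplex h).
have /andP[yj _] := simplex_le1 j (ys_simplex h).
by rewrite !mulr_ge0.
Qed.

Lemma sum_joint h : \sum_p xs h p.1 0 * ys h p.2 0 = 1.
Proof.
have [_ x1] := (simplexP (x := xs h)).1 (xs_simplex h).
have [_ y1] := (simplexP (x := ys h)).1 (ys_simplex h).
rewrite -(pair_bigA _ (fun i j => xs h i 0 * ys h j 0)) /=.
by under eq_bigr do rewrite -mulr_sumr y1 mulr1.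
Qed.

Lemma mean_cst t (c : R) : mean t (fun=> c) = c.
Proof.
elim: t => [|t IH]; first by rewrite /mean /= big_seq1 mul1r.
rewrite meanS -[RHS]IH; congr (mean _ _); apply: funext => h.
by rewrite -mulr_suml sum_joint mul1r.
Qed.

Lemma ler_mean t f g : (forall h, size h = t -> f h <= g h) ->
  mean t f <= mean t g.
Proof.
move=> fg; rewrite /mean big_seq [leRHS]big_seq; apply: ler_sum => h.
by rewrite mem_histories => /eqP ht; rewrite ler_wpM2l ?hist_prob_ge0 ?fg.
Qed.

Lemma ler_norm_mean t f : `|mean t f| <= mean t (fun h => `|f h|).
Proof.
apply: le_trans (ler_norm_sum _ _ _) _; apply: ler_sum => h _.
by rewrite normrM ger0_norm // hist_prob_ge0.
Qed.

End Mean.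

(** * From the probability space to finite averages *)

Section Expectation.
Context {R : realType} {disp : measure_display} {Omega : measurableType disp}.
Context {d1 d2 : nat}.
Variables (P : probability Omega R) (T : nat).
Variables (xs : history d1 d2 -> 'cV[R]_d1) (ys : history d1 d2 -> 'cV[R]_d2).
Variables (I : nat -> Omega -> 'I_d1) (J : nat -> Omega -> 'I_d2).
Hypothesis IJ : sampled_from P T xs ys I J.

Lemma past_consE t i j h :
  [set w | past I J t.+1 w = (i, j) :: h] =
  [set w | [/\ past I J t w = h, I t w = i & J t w = j]].
Proof. by apply/seteqP; split=> w /= [<- <- <-]. Qed.

Lemma measurable_past t h : (t <= T)%N ->
  measurable [set w | past I J t w = h].
Proof.
have [mI mJ _] := IJ.
elim: t h => [|t IH] [|[i j] h] tT.
- by rewrite (_ : [set _ | _] = setT) //; apply/seteqP; split.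
- by rewrite (_ : [set _ | _] = set0) //; apply/seteqP; split.
- by rewrite (_ : [set _ | _] = set0) //; apply/seteqP; split.
rewrite past_consE.
rewrite (_ : [set _ | _] = [set w | past I J t w = h] `&`
  ([set w | I t w = i] `&` [set w | J t w = j])).
  apply: measurableI; first exact: IH (ltnW tT).
  by apply: measurableI; [exact: mI|exact: mJ].
by apply/seteqP; split=> [w /= []|w /= [? []]].
Qed.

Lemma prob_past t h : (t <= T)%N -> size h = t ->
  P [set w | past I J t w = h] = (hist_prob xs ys h)%:E.
Proof.
have [_ _ PIJ] := IJ.
elim: t h => [|t IH] [|[i j] h] // tT.
  move=> _; rewrite (_ : [set _ | _] = setT) ?probability_setT //.
  by apply/seteqP; split.
by move=> [ht]; rewrite past_consE PIJ // IH ?(ltnW tT) // -EFinM.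
Qed.

Lemma size_past t w : size (past I J t w) = t.
Proof. by elim: t => //= t ->. Qed.

(** Only finitely many histories of length [T] exist, so the integrand is a finite combination of
    indicators and is integrated term by term. *)
Lemma expectation_past (f : history d1 d2 -> R) :
  ('E_P[fun w => f (past I J T w)] = (mean xs ys T f)%:E)%E.
Proof.
rewrite unlock.
transitivity (\int[P]_w \sum_(h <- @histories d1 d2 T)
    ((f h)%:E * (\1_[set w | past I J T w = h] w)%:E))%E.
  apply: eq_integral => w _.
  rewrite (bigD1_seq (past I J T w)) /= ?histories_uniq //; last first.
    by rewrite mem_histories size_past.
  rewrite indicE mem_set //= mule1 big1 ?adde0 // => h hw.
  rewrite indicE memNset ?mule0 //= => wh.
  by rewrite wh eqxx in hw.
have intI h : P.-integrable setT
    (fun w => (\1_[set w | past I J T w = h] w)%:E).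
  by apply: integrable_indic; exact: measurable_past.
rewrite integral_sum //; last by move=> h; exact: integrableZl.
rewrite /mean -sumEFin big_seq [RHS]big_seq; apply: eq_bigr => h.
rewrite mem_histories => /eqP ht.
rewrite integralZl // integral_indic //; last exact: measurable_past.
by rewrite setIT [X in (_ * X)%E](prob_past (leqnn T) ht) mulrC EFinM.
Qed.

End Expectation.

(** * Second moment of the estimation error *)

Section SecondMoment.
Context {R : realType} {d1 d2 : nat}.
Variables (adv : history d1 d2 -> 'M[R]_(d1, d2)).
Variables (xs : history d1 d2 -> 'cV[R]_d1) (ys : history d1 d2 -> 'cV[R]_d2).
Variables (s : R) (T : nat).
Hypothesis s0 : 0 < s.
Hypothesis adv1 : forall h, (size h < T)%N -> forall i j, -1 <= adv h i j <= 1.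
Hypothesis txs : forall h, tsimplex s^-1 (xs h).
Hypothesis tys : forall h, tsimplex s^-1 (ys h).

Let delta0 : 0 < s^-1. Proof. by rewrite invr_gt0. Qed.
Let sxs h : simplex (xs h). Proof. exact: (txs h).1. Qed.
Let sys h : simplex (ys h). Proof. exact: (tys h).1. Qed.

Definition est_error h : 'M[R]_(d1, d2) := adv_sum adv h - est_sum adv xs ys h.

(* The cross terms cancel as the estimator is unbiased; the variance is at most
   [A^2 / (x_k y_l) <= s^2]. *)
Lemma est_error_step h k l : (size h < T)%N ->
  \sum_p xs h p.1 0 * ys h p.2 0 * est_error (p :: h) k l ^+ 2 <=
  est_error h k l ^+ 2 + s ^+ 2.
Proof.
move=> hT.
set M := est_error h k l; set A := adv h k l.
have /andP[xk0 _] := tsimplex_le1 k delta0 (txs h).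
have /andP[yl0 _] := tsimplex_le1 l delta0 (tys h).
set w := xs h k 0 * ys h l 0; have w0 : 0 < w by rewrite mulr_gt0.
(* Entry [(k, l)] of the estimator can be nonzero only when the pair [(k, l)] is sampled, and then
   it equals [A / w]. *)
have E p : est_error (p :: h) k l ^+ 2 =
    (M + A) ^+ 2 + (p == (k, l))%:R * ((M + A - A / w) ^+ 2 - (M + A) ^+ 2).
  case: p => i j; rewrite /est_error /= /estimator /M /A /est_error !mxE.
  rewrite xpair_eqE [k == i]eq_sym [l == j]eq_sym.
  case: (eqVneq i k) => [->|_] /=; last by rewrite mulr0; ring.
  case: (eqVneq j l) => [->|_] /=; last by rewrite mulr0; ring.
  by rewrite -/w mulr1 mul1r; ring.
under eq_bigr do rewrite E mulrDr.
rewrite big_split /= -mulr_suml (sum_joint sxs sys) mul1r (bigD1 (k, l)) //=.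
rewrite eqxx mul1r big1 ?addr0 => [|p /negbTE->]; last by rewrite mul0r mulr0.
rewrite -/w.
have -> : w * ((M + A - A / w) ^+ 2 - (M + A) ^+ 2) =
    - 2 * A * (M + A) + A ^+ 2 * w^-1 by field; rewrite gt_eqF.
have A1 : A ^+ 2 <= 1.
  by rewrite -real_normK ?num_real // expr_le1 // ler_norml; exact: adv1.
have wV : w^-1 <= s ^+ 2.
  rewrite /w invfM expr2 ler_pM ?invr_ge0 //; try exact: ltW.
    by rewrite invf_ple ?posrE //; exact: (txs h).2.
  by rewrite invf_ple ?posrE //; exact: (tys h).2.
have wV0 : 0 <= w^-1 by rewrite invr_ge0 ltW.
have : A ^+ 2 * w^-1 <= 1 * s ^+ 2 by rewrite ler_pM // sqr_ge0.
have := sqr_ge0 A.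
lra.
Qed.

Lemma mean_est_error_sqr t k l : (t <= T)%N ->
  mean xs ys t (fun h => est_error h k l ^+ 2) <= t%:R * s ^+ 2.
Proof.
elim: t => [_|t IH tT].
  by rewrite /mean /= big_seq1 /est_error /= subrr mxE expr0n mulr0 mul0r.
rewrite meanS.
apply: (@le_trans _ _ (mean xs ys t (fun h => est_error h k l ^+ 2 + s ^+ 2))).
  by apply: ler_mean => // h ht; apply: est_error_step; rewrite ht.
rewrite mean_add mean_cst // -natr1 mulrDl mul1r lerD2r.
exact: IH (ltnW tT).
Qed.

Lemma mean_norm_est_error : T%:R = s ^+ 6 ->
  mean xs ys T (fun h => \sum_k \sum_l `|est_error h k l|) <=
  d1%:R * d2%:R * s ^+ 4.
Proof.
move=> Ts; rewrite mean_sum.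
have -> : d1%:R * d2%:R * s ^+ 4 = \sum_(k < d1) \sum_(l < d2) s ^+ 4.
  by rewrite !sumr_const !card_ord -mulrnA -[RHS]mulr_natl natrM; ring.
apply: ler_sum => k _; rewrite mean_sum; apply: ler_sum => l _.
have s4 : 0 < s ^+ 4 by rewrite exprn_gt0.
(* AM-GM: [|m| <= s^4 / 2 + m^2 / (2 s^4)] *)
apply: (@le_trans _ _ (mean xs ys T (fun h => s ^+ 4 / 2 +
    (s ^+ 4)^-1 / 2 * est_error h k l ^+ 2))).
  apply: ler_mean => // h _.
  rewrite -[est_error h k l ^+ 2]real_normK ?num_real //.
  set m := `|_|.
  have -> : s ^+ 4 / 2 + (s ^+ 4)^-1 / 2 * m ^+ 2 =
      m + (s ^+ 4)^-1 / 2 * (s ^+ 4 - m) ^+ 2 by field; rewrite gt_eqF.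
  by rewrite lerDl mulr_ge0 ?sqr_ge0 // divr_ge0 // invr_ge0 ltW.
rewrite mean_add mean_cst // mean_mull.
have c0 : 0 <= (s ^+ 4)^-1 / 2 by rewrite divr_ge0 // invr_ge0 ltW.
have := ler_wpM2l c0 (mean_est_error_sqr k l (leqnn T)).
rewrite Ts.
have -> : (s ^+ 4)^-1 / 2 * (s ^+ 6 * s ^+ 2) = s ^+ 4 / 2.
  by field; rewrite gt_eqF.
lra.
Qed.

End SecondMoment.

(** * Harmonic sums and the final bound *)

Lemma harmonic_le (R : realType) n : (0 < n)%N ->
  \sum_(k < n) k.+1%:R^-1 <= 1 + ln n%:R :> R.
Proof.
case: n => // n _; elim: n => [|n IH].
  by rewrite big_ord1 invr1 ln1 addr0.
rewrite big_ord_recr /=.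
have a0 : 0 < n.+1%:R :> R by rewrite ltr0n.
have b0 : 0 < n.+2%:R :> R by rewrite ltr0n.
(* At the ratio of consecutive integers this says that the logarithm grows by at least
   [n.+2%:R^-1]. *)
have := ln_le_subr1 (divr_gt0 a0 b0).
rewrite ln_div ?posrE //.
have -> : n.+1%:R / n.+2%:R - 1 = - n.+2%:R^-1 :> R.
  have -> : n.+1%:R = n.+2%:R - 1 :> R by rewrite -[n.+2%:R]natr1 addrK.
  by field; rewrite gt_eqF.
move: IH; move: (n.+2%:R^-1) => r; lra.
Qed.

Theorem theorem5 (R : realType) :
  exists C : R,
  forall (d1 d2 T : nat) (delta eta : R),
    (2 <= d1)%N -> (2 <= d2)%N -> (0 < T)%N ->
    delta = T%:R `^ (- (1 / 6)) ->
    delta < Num.min (1 / d1%:R) (1 / d2%:R) ->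
    eta = T%:R `^ (1 / 6) ->
  forall (adv : history d1 d2 -> 'M[R]_(d1, d2)),
    (forall h : history d1 d2, (size h < T)%N ->
       forall i j, -1 <= adv h i j <= 1) ->
  forall (xs : history d1 d2 -> 'cV[R]_d1) (ys : history d1 d2 -> 'cV[R]_d2),
    bandit_omg_rftl eta delta adv xs ys ->
  forall (disp : measure_display) (Omega : measurableType disp)
    (P : probability Omega R)
    (I : nat -> Omega -> 'I_d1) (J : nat -> Omega -> 'I_d2),
    sampled_from P T xs ys I J ->
    (`| 'E_P [ nash_regret T adv I J ] |
      <= (C * (d1%:R + d2%:R) * ln T%:R * T%:R `^ (5 / 6))%:E)%E.
Proof.
exists 20 => d1 d2 T delta s d12 d22 T0 deltaE delta_lt sE adv adv1 xs ys alg.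
move=> disp Omega P I J IJ.
have TR0 : 0 < T%:R :> R by rewrite ltr0n.
have s0 : 0 < s by rewrite sE powR_gt0.
have dE : delta = s^-1 by rewrite deltaE powRN sE.
have Ts : T%:R = s ^+ 6 :> R.
  by rewrite sE -powR_mulrn ?powR_ge0 // -powRrM divfK ?pnatr_eq0 //
    powRr1 ?ltW.
have s5 : T%:R `^ (5 / 6) = s ^+ 5.
  by rewrite sE -powR_mulrn ?powR_ge0 // -powRrM mulrAC mul1r.
move: delta_lt; rewrite lt_min !div1r dE => /andP[ds1 ds2].
have d10 : 0 < d1%:R :> R by rewrite ltr0n; exact: leq_trans d12.
have d20 : 0 < d2%:R :> R by rewrite ltr0n; exact: leq_trans d22.
have {ds1}d1s : d1%:R <= s by rewrite -lef_pV2 ?posrE // ltW.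
have {ds2}d2s : d2%:R <= s by rewrite -lef_pV2 ?posrE // ltW.
have d1R : 2 <= d1%:R :> R by rewrite ler_nat.
have d2R : 2 <= d2%:R :> R by rewrite ler_nat.
have s2 : 2 <= s := le_trans d1R d1s.
have s1 : 1 <= s by lra.
rewrite dE in alg.
have ts h := bandit_tsimplex s1 alg h.
have txs h := (ts h).1; have tys h := (ts h).2.
have sxs h := (txs h).1; have sys h := (tys h).1.
have -> : nash_regret T adv I J =
    (fun w => history_regret adv (past I J T w)).
  by apply: funext => w; exact: nash_regretE.
rewrite (expectation_past IJ) abse_EFin lee_fin.
apply: le_trans (ler_norm_mean sxs sys _ _) _.
pose K := 32 * s ^+ 5 * \sum_(k < T) k.+1%:R^-1 + 4 * s ^+ 5 * (d1%:R + d2%:R).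
apply: (@le_trans _ _ (mean xs ys T (fun h => K +
    \sum_k \sum_l `|est_error adv xs ys h k l|))).
  by apply: ler_mean => // h hT; exact: history_regret_le.
rewrite mean_add mean_cst // s5.
have := mean_norm_est_error s0 adv1 txs tys Ts.
set E := mean _ _ _ _ => hE.
have s50 : 0 < s ^+ 5 by rewrite exprn_gt0.
have s40 : 0 <= d1%:R * s ^+ 4 by rewrite mulr_ge0 // ?exprn_ge0 // ltW.
(* As [d2%:R <= s], the martingale term [d1%:R * d2%:R * s ^+ 4] is at most [d1%:R * s ^+ 5], linear
   in the dimension. *)
have h1 := ler_wpM2l s40 d2s.
(* [s >= 2] gives [ln s >= 1 - s^-1 >= 1 / 2], and [ln T%:R] is six times [ln s]. *)
have L3 : 3 <= ln T%:R :> R.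
  rewrite Ts lnXn // -mulr_natl.
  have := ln_le_subr1 (divr_gt0 ltr01 s0); rewrite div1r lnV ?posrE //.
  have : s^-1 <= 2^-1 by rewrite lef_pV2 ?posrE.
  lra.
have h2 : s ^+ 5 * \sum_(k < T) k.+1%:R^-1 <= s ^+ 5 * (1 + ln T%:R).
  by rewrite ler_wpM2l ?harmonic_le // ltW.
set L := ln T%:R in L3 h2 *; set D : R := d1%:R + d2%:R.
have D4 : 4 <= D by rewrite /D; lra.
(* By [D >= 4] and [L >= 3], the terms [32], [32 * L], [4 * D] and [d1%:R] are at most 8/3, 8, 4/3
   and 1/3 times [D * L]; these factors sum to less than 20. *)
have h3 : s ^+ 5 * (32 * (1 + L) + 4 * D + d1%:R) <= s ^+ 5 * (20 * D * L).
  rewrite ler_wpM2l //; first exact: ltW.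
  have : 4 * L <= D * L by rewrite ler_wpM2r //; lra.
  have : D * 3 <= D * L by rewrite ler_wpM2l //; lra.
  have : d1%:R <= D by rewrite /D; lra.
  lra.
rewrite /K -/D; move: (\sum_(k < T) _) h2 => H h2.
lra.
Qed.
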